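(* Let $(\Omega,\mathcal{F},\mu)$ be a hyperfinite probability space and let $\mathcal{G}$ be a hyperfinite algebra on $\Omega$. Let $\mathcal{H}$ be the internal algebra generated by $\mathcal{F}\cup\mathcal{G}$. Then there exists an internal probability measure $P$ on $\mathcal{H}$ such that $(\Omega,\mathcal{H},P)$ is Loeb equivalent to $(\Omega,\mathcal{F},\mu)$ if and only if $\mathcal{H}\subset\overline{\mathcal{F}}$.
   Context: Work in a nonstandard extension satisfying transfer and (at least countable) saturation. An internal probability space is a triple $(\Omega,\mathcal{F},\mu)$ where $\Omega$ is an internal set, $\mathcal{F}$ is an internal algebra of internal subsets of $\Omega$, and $\mu:\mathcal{F}\to{}^{*}[0,1]$ is an internal finitely additive probability measure. It is called hyperfinite (a hyperfinite probability space) if $\mathcal{F}$ is hyperfinite; $\Omega$ need not be hyperfinite. A hyperfinite algebra on $\Omega$ is an internal algebra of internal subsets of $\Omega$ that is hyperfinite as a set. The internal algebra generated by an internal family is the smallest internal algebra containing it. Write $\mathsf{st}$ for the standard part. The Loeb extension of $(\Omega,\mathcal{F},\mu)$ is the countably additive probability space $(\Omega,\overline{\mathcal{F}},\overline{\mu})$, where $\overline{\mathcal{F}}$ consists of all (not necessarily internal) $B\subset\Omega$ with $\sup\{\mathsf{st}(\mu(A)):A\in\mathcal{F},A\subset B\}=\inf\{\mathsf{st}(\mu(C)):C\in\mathcal{F},B\subset C\}$, and $\overline{\mu}(B)$ is this common value. Internal probability spaces $(\Omega,\mathcal{F},\mu)$ and $(\Omega,\mathcal{G},\nu)$ are Loeb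 equivalent if $\overline{\mathcal{F}}=\overline{\mathcal{G}}$ and $\overline{\nu}=\overline{\mu}$. *)

(* Defs.v *)
From mathcomp Require Import all_boot all_order all_algebra.
From mathcomp Require Import all_classical all_reals.

Set Implicit Arguments.
Unset Strict Implicit.
Unset Printing Implicit Defensive.

Import Order.TTheory GRing.Theory Num.Theory.

Local Open Scope classical_set_scope.
Local Open Scope ring_scope.

(* Nonstandard extensions are presented as in Robinson's original, type-theoretic
   setting: the superstructure is the full hierarchy of finite types over the
   reals and an arbitrary set X of individuals, closed under powersets and
   function sets (relations between different types are curried functions).
   Because X is arbitrary, an extension of a cumulative superstructure over S is
   covered by letting X be any of its levels V_n(S): an internal subset of
   *V_n(S) is then an internal set of individuals. *)

Inductive htype : Type :=
| TBase
| TReal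
| TPow of htype
| TFun of htype & htype.

(* A structure for the language with application and membership. *)
Record hstruct := HStruct {
  dom : htype -> Type;
  app : forall s t, dom (TFun s t) -> dom s -> dom t;
  mem : forall s, dom s -> dom (TPow s) -> Prop }.
Arguments app {h s t}.
Arguments mem {h s}.

Fixpoint std_dom (R : realType) (X : Type) (s : htype) : Type :=
  match s with
  | TBase => X
  | TReal => R
  | TPow t => set (std_dom R X t)
  | TFun t u => std_dom R X t -> std_dom R X u
  end.

Definition std (R : realType) (X : Type) : hstruct :=
  @HStruct (std_dom R X) (fun s t f x => f x) (fun s x A => A x).

(* Formulas in context (well-typed de Bruijn indices).  There are no constants:
   the parameters of a formula are the values of its free variables. *)

Inductive var : seq htype -> htype -> Type :=
| VZ s G : var (s :: G) s
| VS s t G : var G s -> var (t :: G) s.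

Inductive term (G : seq htype) : htype -> Type :=
| Var s : var G s -> term G s
| App s t : term G (TFun s t) -> term G s -> term G t.

Inductive formula : seq htype -> Type :=
| FEq G s : term G s -> term G s -> formula G
| FMem G s : term G s -> term G (TPow s) -> formula G
| FNot G : formula G -> formula G
| FAnd G : formula G -> formula G -> formula G
| FOr G : formula G -> formula G -> formula G
| FImp G : formula G -> formula G -> formula G
| FAll G s : formula (s :: G) -> formula G
| FEx G s : formula (s :: G) -> formula G.

Fixpoint env (D : htype -> Type) (G : seq htype) : Type :=
  match G with
  | [::] => unit
  | s :: G' => (D s * env D G')%type
  end.

Fixpoint env_map (D E : htype -> Type) (f : forall s, D s -> E s)
    (G : seq htype) : env D G -> env E G :=
  match G with
  | [::] => fun e => e
  | s :: G' => fun e => (f s e.1, env_map f e.2)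
  end.

Fixpoint lookup (D : htype -> Type) G s (x : var G s) : env D G -> D s :=
  match x with
  | VZ _ _ => fun e => e.1
  | VS _ _ _ y => fun e => lookup y e.2
  end.

Fixpoint eval (M : hstruct) G s (t : term G s) (e : env (dom M) G) : dom M s :=
  match t with
  | Var _ x => lookup x e
  | App _ _ f u => app (eval f e) (eval u e)
  end.

Fixpoint holds (M : hstruct) G (p : formula G) : env (dom M) G -> Prop :=
  match p with
  | FEq _ _ t u => fun e => eval t e = eval u e
  | FMem _ _ t u => fun e => mem (eval t e) (eval u e)
  | FNot _ q => fun e => ~ holds q e
  | FAnd _ q r => fun e => holds q e /\ holds r e
  | FOr _ q r => fun e => holds q e \/ holds r e
  | FImp _ q r => fun e => holds q e -> holds r e
  | FAll _ s q => fun e => forall a : dom M s, holds q (a, e)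
  | FEx _ s q => fun e => exists a : dom M s, holds q (a, e)
  end.

(* [dom internal s] is *V_s; since membership is transferred, its elements for
   s = TPow t are (determined by their extensions) the internal subsets of *V_t. *)
Record nonstd_ext (R : realType) (X : Type) := NonstdExt {
  internal :> hstruct;
  star : forall s, std_dom R X s -> dom internal s;
  transfer : forall G (p : formula G) (e : env (std_dom R X) G),
    holds (M := std R X) p e <-> holds (M := internal) p (env_map star e);
  saturation : forall s (A : nat -> dom internal (TPow s)),
    (forall n, exists x, forall k, (k <= n)%N -> mem x (A k)) ->
    exists x, forall k, mem x (A k) }.
Arguments star {R X} n s _.

Section Loeb.
Variables (R : realType) (X : Type) (N : nonstd_ext R X).

Notation hreal := (dom N TReal).
Notation obj s := (dom N s).

Definition hconst (r : R) : hreal := star N TReal r.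

Definition hlift2 (f : R -> R -> R) (x y : hreal) : hreal :=
  app (app (star N (TFun TReal (TFun TReal TReal)) f) x) y.

Definition hadd : hreal -> hreal -> hreal := hlift2 (fun x y => x + y).

Definition hdist : hreal -> hreal -> hreal := hlift2 (fun x y => `|x - y|).

Definition hle (x y : hreal) : Prop :=
  mem x (app (star N (TFun TReal (TPow TReal)) (fun y => [set x | x <= y])) y).

Definition near_real (x : hreal) (r : R) : Prop :=
  forall e : R, 0 < e -> hle (hdist x (hconst r)) (hconst e).

(* Default value 0 at infinite x, never reached on values in *[0,1]. *)
Definition st (x : hreal) : R := xget 0 [set r | near_real x r].

Section Carrier.
Variable s : htype.

Definition ext t (A : obj (TPow t)) : set (obj t) := [set x | mem x A].

Definition fam (F : obj (TPow (TPow s))) : set (set (obj s)) :=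
  [set ext A | A in ext F].

Definition set_algebra T (D : set T) (C : set (set T)) : Prop :=
  [/\ forall A, C A -> A `<=` D, C D, forall A, C A -> C (D `\` A)
    & setU_closed C].

Definition internal_algebra (O : obj (TPow s)) (F : obj (TPow (TPow s))) : Prop :=
  set_algebra (ext O) (fam F).

Definition hyperfinite t (A : obj (TPow t)) : Prop :=
  mem A (star N (TPow (TPow t)) [set B | finite_set B]).

Definition hyperfinite_algebra (O : obj (TPow s)) (F : obj (TPow (TPow s))) : Prop :=
  internal_algebra O F /\ hyperfinite F.

Definition generated_algebra (O : obj (TPow s)) (K : set (obj (TPow s)))
    (H : obj (TPow (TPow s))) : Prop :=
  [/\ internal_algebra O H, K `<=` ext H
    & forall H', internal_algebra O H' -> K `<=` ext H' -> ext H `<=` ext H'].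

(* The internal function F -> *[0,1] is given by an internal function on all
   internal sets, of which only the values on F matter; conversely an
   internal function on F extends internally by the value 0. *)
Definition internal_prob_space (O : obj (TPow s)) (F : obj (TPow (TPow s)))
    (mu : obj (TFun (TPow s) TReal)) : Prop :=
  [/\ internal_algebra O F,
      forall A, ext F A -> hle (hconst 0) (app mu A) /\ hle (app mu A) (hconst 1),
      app mu O = hconst 1
    & forall A B C, ext F A -> ext F B -> ext F C ->
        ext A `&` ext B = set0 -> ext C = ext A `|` ext B ->
        app mu C = hadd (app mu A) (app mu B)].

Definition hyperfinite_prob_space (O : obj (TPow s)) (F : obj (TPow (TPow s)))
    (mu : obj (TFun (TPow s) TReal)) : Prop :=
  internal_prob_space O F mu /\ hyperfinite F.

Definition loeb_inner (F : obj (TPow (TPow s))) (mu : obj (TFun (TPow s) TReal))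
    (B : set (obj s)) : R :=
  sup [set st (app mu A) | A in [set A | ext F A /\ ext A `<=` B]].

Definition loeb_outer (F : obj (TPow (TPow s))) (mu : obj (TFun (TPow s) TReal))
    (B : set (obj s)) : R :=
  inf [set st (app mu C) | C in [set C | ext F C /\ B `<=` ext C]].

Definition loeb_algebra (O : obj (TPow s)) (F : obj (TPow (TPow s)))
    (mu : obj (TFun (TPow s) TReal)) : set (set (obj s)) :=
  [set B | B `<=` ext O /\ loeb_inner F mu B = loeb_outer F mu B].

Definition loeb_measure (F : obj (TPow (TPow s)))
    (mu : obj (TFun (TPow s) TReal)) (B : set (obj s)) : R :=
  loeb_inner F mu B.

Definition loeb_equivalent (O : obj (TPow s))
    (F : obj (TPow (TPow s))) (mu : obj (TFun (TPow s) TReal))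
    (G : obj (TPow (TPow s))) (nu : obj (TFun (TPow s) TReal)) : Prop :=
  loeb_algebra O F mu = loeb_algebra O G nu /\
  forall B, loeb_algebra O F mu B -> loeb_measure F mu B = loeb_measure G nu B.

End Carrier.
End Loeb.

(* Main.v *)
Require Import Defs.
From mathcomp Require Import all_boot all_order all_algebra.
From mathcomp Require Import all_classical all_reals.
From mathcomp Require Import lra.

(** Everything rests on one fact about finite algebras: a finitely additive
    measure on a finite algebra [F] extends to all subsets. One picks a point in
    each nonempty atom of [F] and lets that point carry the mass of its atom
    ([exists_content_extension]). By transfer, the internal measure [mu] on the
    hyperfinite algebra [F] extends to an internal finitely additive measure on
    all internal sets, hence on every internal algebra [H] containing [F]
    ([prob_extension]).

    Suppose that every set of [H] is Loeb measurable for [mu], and let [P]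
    on [H] extend [mu]. For [A] in [H], the standard part of [P A] lies between
    the inner and the outer measures of [A] computed with [F], because [P] is
    monotone and agrees with [mu] on [F]; these two coincide, so all three
    numbers do. Thus [A] is approximated from inside and from outside by sets of
    [F] as closely as one likes, and an arbitrary subset of the space has the
    same inner measure, and the same outer measure, for [H] as for [F]
    ([loeb_inner_extension], [loeb_outer_extension]). Loeb equivalence follows.

    Conversely the sets of [H] are Loeb measurable for any internal
    probability [P] on [H] ([sub_loeb_algebra]), and Loeb equivalence says that
    this Loeb algebra is that of [mu]. *)

Set Implicit Arguments.
Unset Strict Implicit.
Unset Printing Implicit Defensive.

Import Order.TTheory GRing.Theory Num.Theory.

Local Open Scope ring_scope.
Local Open Scope classical_set_scope.

(** * Extending a measure from a finite algebra to all subsets *)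

Definition content (R : numDomainType) (T : Type) (P : set T -> R) : Prop :=
  (forall A, 0 <= P A) /\
  (forall A B, A `&` B = set0 -> P (A `|` B) = P A + P B).

Lemma content_add (R : numDomainType) (T : Type) (P Q : set T -> R) :
  content P -> content Q -> content (fun A => P A + Q A).
Proof.
move=> [P0 PD] [Q0 QD]; split=> [A|A B AB]; first exact: addr_ge0.
by rewrite PD// QD// addrACA.
Qed.

Lemma content_point (R : numDomainType) (T : Type) (w : T) (c : R) :
  0 <= c -> content (fun A => c *+ `[< A w >]).
Proof.
move=> c0; split=> [A|A B AB]; first exact: mulrn_wge0.
rewrite -mulrnDr; congr (_ *+ _).
have [Aw|nAw] := pselect (A w); have [Bw|nBw] := pselect (B w).
- by have : (A `&` B) w by []; rewrite AB.
- by rewrite (asboolT Aw) (asboolF nBw) asboolT//; left.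
- by rewrite (asboolF nAw) (asboolT Bw) asboolT//; right.
- by rewrite (asboolF nAw) (asboolF nBw) asboolF// => -[].
Qed.

Section FiniteRing.
Variables (R : numDomainType) (T : Type) (F : set (set T)) (mu : set T -> R).
Hypothesis FD : forall A B, F A -> F B -> F (A `\` B).
Hypothesis mu_ge0 : forall A, F A -> 0 <= mu A.
Hypothesis muU : forall A B, F A -> F B -> F (A `|` B) ->
  A `&` B = set0 -> mu (A `|` B) = mu A + mu B.

Lemma ring_setI A B : F A -> F B -> F (A `&` B).
Proof. by move=> FA FB; rewrite -setDD; apply: (FD FA); exact: FD. Qed.

Lemma ring_measure_set0 A : F A -> mu set0 = 0.
Proof.
move=> FA; have F0 : F set0 by rewrite -(setDv A); exact: FD.
have := @muU set0 set0 F0 F0; rewrite setU0 setI0 => /(_ F0 erefl).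
by move=> /(congr1 (fun x => x - mu set0)); rewrite subrr addrK.
Qed.

(** Induction on a list of members of [F] that may cut [A] into two nonempty
    pieces. When none is left, [A] is empty or an atom, and a point of [A] carries
    its whole mass; otherwise the first member [D] of the list cuts [A] into
    [A `&` D] and [A `\` D], which [D] no longer cuts, and the contents obtained
    for the two pieces are added. No atom has to be enumerated. *)
Lemma exists_content_trace (l : seq (set T)) A : F A ->
  (forall B, F B -> B \notin l -> A `&` B = set0 \/ A `<=` B) ->
  exists2 P : set T -> R, content P & forall B, F B -> P B = mu (A `&` B).
Proof.
elim: l A => [|D l IH] A FA Al.
  have [[w Aw]|/set0P/negP/negPn/eqP A0] := pselect (A !=set0).
    exists (fun B => mu A *+ `[< B w >]); first exact/content_point/mu_ge0.
    move=> B FB; have [AB|AB] := Al B FB isT.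
      rewrite AB asboolF ?(ring_measure_set0 FA)// => Bw.
      by have : (A `&` B) w by []; rewrite AB.
    by rewrite asboolT ?(setIidl AB)//; exact: AB.
  exists (fun=> 0); first by split=> // *; rewrite addr0.
  by move=> B FB; rewrite A0 set0I (ring_measure_set0 FA).
have [FDn|nFD] := pselect (F D); last first.
  apply: IH => // B FB Bl; apply: Al => //; rewrite inE negb_or Bl andbT.
  by apply/eqP => BD; apply: nFD; rewrite -BD.
have FI := ring_setI FA FDn; have FDD := FD FA FDn.
have [|P1 cP1 P1E] := IH (A `&` D) FI.
  move=> B FB Bl; have [->|BD] := pselect (B = D).
    by right; exact: subIsetr.
  have [|AB|AB] := Al B FB; first by rewrite inE negb_or Bl andbT; apply/eqP.
    by left; rewrite setIAC AB set0I.
  by right=> x [/AB].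
have [|P2 cP2 P2E] := IH (A `\` D) FDD.
  move=> B FB Bl; have [->|BD] := pselect (B = D).
    by left; rewrite setDE -setIA setICl setI0.
  have [|AB|AB] := Al B FB; first by rewrite inE negb_or Bl andbT; apply/eqP.
    by left; rewrite setDE setIAC AB set0I.
  by right=> x [/AB].
exists (fun B => P1 B + P2 B); first exact: content_add.
have E B : A `&` D `&` B `|` (A `\` D) `&` B = A `&` B.
  by rewrite -setIUl setUIDK.
move=> B FB; rewrite P1E// P2E// -muU ?E//; do ?exact: ring_setI.
by rewrite -subset0 => x [[[_ Dx] _] [[_ /(_ Dx)]]].
Qed.

Lemma exists_content_extension O : finite_set F -> F O ->
  exists2 P : set T -> R, content P &
    forall A, F A -> A `<=` O -> P A = mu A.
Proof.
move=> /finite_seqP[l Fl] FO.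
have [|P cP PE] := @exists_content_trace l O FO.
  by move=> B; rewrite Fl /= => ->.
by exists P => // A FA AO; rewrite PE// setIC (setIidl AO).
Qed.

End FiniteRing.

(** * Transferred facts *)

(** Formulas are written with de Bruijn variables: [v0] is the variable bound last.
    A comment inside a formula lists, from [v0] on, the variables in scope. *)

Local Notation v0 := (VZ _ _).
Local Notation v1 := (VS _ v0).
Local Notation v2 := (VS _ v1).
Local Notation v3 := (VS _ v2).
Local Notation v4 := (VS _ v3).
Local Notation v5 := (VS _ v4).
Local Notation v6 := (VS _ v5).
Local Notation v7 := (VS _ v6).
Local Notation v8 := (VS _ v7).
Local Notation v9 := (VS _ v8).

Local Coercion Var : var >-> term.
Local Infix "==>f" := FImp (at level 68, right associativity).
Local Infix "&&f" := FAnd (at level 67, right associativity).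
Local Infix "||f" := FOr (at level 67, right associativity).
Local Infix "=f" := FEq (at level 60, no associativity).
Local Infix "\inf" := FMem (at level 60, no associativity).
Local Notation "f @f x" := (App f x) (at level 40, left associativity).

Definition fiff G (p q : formula G) : formula G := (p ==>f q) &&f (q ==>f p).

Definition fsub G s (A B : var G (TPow s)) : formula G :=
  FAll (s := s) (v0 \inf VS s A ==>f v0 \inf VS s B).

Definition feqset G s (A B : var G (TPow s)) : formula G :=
  FAll (s := s) (fiff (v0 \inf VS s A) (v0 \inf VS s B)).

Definition fisD G s (C A B : var G (TPow s)) : formula G :=
  FAll (s := s)
    (fiff (v0 \inf VS s C) (v0 \inf VS s A &&f FNot (v0 \inf VS s B))).

Definition fisU G s (C A B : var G (TPow s)) : formula G :=
  FAll (s := s) (fiff (v0 \inf VS s C) (v0 \inf VS s A ||f v0 \inf VS s B)).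

Definition fdisj G s (A B : var G (TPow s)) : formula G :=
  FAll (s := s) (FNot (v0 \inf VS s A &&f v0 \inf VS s B)).

(** Extension of a finitely additive [mu] from a finite family [F] closed under
    difference to all sets, with the values prescribed on the members of [F]
    inside [O]. The standard objects it mentions are its free variables: the
    class of finite families, the order as a function [y |-> {x | x <= y}],
    addition, and zero. *)
Definition fextension s : formula
    [:: TPow (TPow (TPow s)); TFun TReal (TPow TReal);
        TFun TReal (TFun TReal TReal); TReal] :=
  FAll (s := TFun (TPow s) TReal) (FAll (s := TPow (TPow s)) (FAll (s := TPow s)
    (* O F mu fin le add zero *)
    (v1 \inf v3 ==>f
     v0 \inf v1 ==>f
     (* B A O F mu fin le add zero, then C in front *)
     FAll (FAll (v1 \inf v3 ==>f v0 \inf v3 ==>f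
       FEx (v0 \inf v4 &&f fisD v0 v2 v1))) ==>f
     (* A O F mu fin le add zero *)
     FAll (v0 \inf v2 ==>f v7 \inf (v5 @f (v3 @f v0))) ==>f
     (* C B A O F mu fin le add zero *)
     FAll (FAll (FAll (v2 \inf v4 ==>f v1 \inf v4 ==>f v0 \inf v4 ==>f
       fdisj v2 v1 ==>f fisU v0 v2 v1 ==>f
       v5 @f v0 =f v8 @f (v5 @f v2) @f (v5 @f v1)))) ==>f
     FEx (s := TFun (TPow s) TReal)
       ((* A P O F mu fin le add zero *)
        FAll (v8 \inf (v6 @f (v1 @f v0))) &&f
        (* C B A P O F mu fin le add zero *)
        FAll (FAll (FAll (fdisj v2 v1 ==>f fisU v0 v2 v1 ==>f
          v3 @f v0 =f v9 @f (v3 @f v2) @f (v3 @f v1)))) &&f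
        (* A P O F mu fin le add zero *)
        FAll (v0 \inf v3 ==>f fsub v0 v2 ==>f v1 @f v0 =f v4 @f v0))))).

Section Transfer.
Variables (R : realType) (X : Type) (N : nonstd_ext R X).

Lemma hle_trans (x y z : dom N TReal) : hle x y -> hle y z -> hle x z.
Proof.
pose p : formula [:: TFun TReal (TPow TReal)] :=
  FAll (FAll (FAll
    (v2 \inf v3 @f v1 ==>f v1 \inf v3 @f v0 ==>f v2 \inf v3 @f v0))).
apply: ((transfer N p (fun y : R => [set x | x <= y], tt)).1 _).
by move=> /= a b c; exact: le_trans.
Qed.

Lemma hle_total (x y : dom N TReal) : hle x y \/ hle y x.
Proof.
pose p : formula [:: TFun TReal (TPow TReal)] :=
  FAll (FAll (v1 \inf v2 @f v0 ||f v0 \inf v2 @f v1)).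
apply: ((transfer N p (fun y : R => [set x | x <= y], tt)).1 _).
by move=> /= a b; apply/orP; exact: le_total.
Qed.

Lemma hle_hconst (a b : R) : hle (hconst N a) (hconst N b) <-> a <= b.
Proof.
pose p : formula [:: TFun TReal (TPow TReal); TReal; TReal] :=
  v1 \inf v0 @f v2.
exact: iff_sym (transfer N p (fun y : R => [set x | x <= y], (a, (b, tt)))).
Qed.

Lemma hle_addr (x y : dom N TReal) : hle (hconst N 0) y -> hle x (hadd x y).
Proof.
pose p : formula [:: TFun TReal (TPow TReal); TFun TReal (TFun TReal TReal); TReal] :=
  FAll (FAll (v4 \inf v2 @f v0 ==>f v1 \inf v2 @f (v3 @f v1 @f v0))).
apply: ((transfer N p (fun y : R => [set x | x <= y],
  (fun x y : R => x + y, (0, tt)))).1 _).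
by move=> /= a b b0; rewrite /= lerDl.
Qed.

Lemma hdist_le (r e : R) (x : dom N TReal) :
  hle (hdist x (hconst N r)) (hconst N e) <->
  hle (hconst N (r - e)) x /\ hle x (hconst N (r + e)).
Proof.
pose p : formula [:: TFun TReal (TPow TReal); TFun TReal (TFun TReal TReal);
    TReal; TReal; TReal; TReal] :=
  FAll (fiff ((v2 @f v0 @f v3) \inf v1 @f v4)
    (v5 \inf v1 @f v0 &&f v0 \inf v1 @f v6)).
have std_p : holds (M := std R X) p (fun y : R => [set x | x <= y],
    (fun x y : R => `|x - y|, (r, (e, (r - e, (r + e, tt)))))).
  by move=> /= a; rewrite ler_distl; split=> [/andP//|[? ?]]; apply/andP.
exact: ((transfer N p _).1 std_p x).
Qed.

(** Transfer of extensionality. *)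
Lemma ext_inj (s : htype) : injective (@ext R X N s).
Proof.
pose p : formula [::] := FAll (s := TPow s) (FAll (s := TPow s)
  (feqset v1 v0 ==>f v1 =f v0)).
move=> A B AB; apply: ((transfer N p tt).1 _).
  by move=> /= C D CD; apply/seteqP; split=> x /CD.
by move=> x /=; change (ext A x <-> ext B x); rewrite AB.
Qed.

(** Transfer of [exists_content_extension]. *)
Lemma exists_internal_extension (s : htype) (O : dom N (TPow s))
    (F : dom N (TPow (TPow s))) (mu : dom N (TFun (TPow s) TReal)) :
  hyperfinite F -> ext F O ->
  (forall A B, ext F A -> ext F B -> exists2 C, ext F C & ext C = ext A `\` ext B) ->
  (forall A, ext F A -> hle (hconst N 0) (app mu A)) ->
  (forall A B C, ext F A -> ext F B -> ext F C ->
    ext A `&` ext B = set0 -> ext C = ext A `|` ext B ->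
    app mu C = hadd (app mu A) (app mu B)) ->
  exists P : dom N (TFun (TPow s) TReal),
    [/\ forall A, hle (hconst N 0) (app P A),
        forall A B C, ext A `&` ext B = set0 -> ext C = ext A `|` ext B ->
          app P C = hadd (app P A) (app P B)
      & forall A, ext F A -> ext A `<=` ext O -> app P A = app mu A].
Proof.
have std_ext : holds (M := std R X) (fextension s)
    ([set B | finite_set B], (fun y : R => [set x | x <= y],
      (fun x y : R => x + y, (0, tt)))).
  move=> /= m C D Cfin CD CDiff m0 mU.
  have [||P [P0 PD] Pm] := @exists_content_extension R _ C m _ m0 _ D Cfin CD.
  - move=> A B CA CB; have [E [CE EAB]] := CDiff A B CA CB.
    by suff -> : A `\` B = E by []; apply/seteqP; split=> x /EAB.
  - move=> A B CA CB CAB AB; apply: mU => // x /= ABx.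
    by have : (A `&` B) x by []; rewrite AB.
  exists P; split => //; split=> [A B E AB EAB|A CA AD]; last exact: Pm.
  have -> : E = A `|` B by apply/seteqP; split=> x /EAB.
  by apply: PD; rewrite -subset0 => x /AB.
move=> Ffin FO FD mu0 muU.
have [||||A B C FA FB FC AB CAB|P [P0 [PU PE]]] :=
  (transfer N (fextension s) _).1 std_ext mu F O.
- exact: Ffin.
- exact: FO.
- move=> A B FA FB; have [C FC CE] := FD A B FA FB; exists C; split=> // x.
  by change (ext C x <-> ext A x /\ ~ ext B x); rewrite CE.
- exact: mu0.
- apply: muU => //; first by rewrite -subset0 => x /AB.
  by apply/seteqP; split=> x /CAB.
exists P; split=> [//|A B C AB CAB|A FA AO]; last exact: PE.
apply: PU => x.
  by move=> ABx; have : (ext A `&` ext B) x by []; rewrite AB.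
by change (ext C x <-> ext A x \/ ext B x); rewrite CAB.
Qed.

End Transfer.

(** * Standard parts *)

Section StandardPart.
Variables (R : realType) (X : Type) (N : nonstd_ext R X).
Implicit Types x y : dom N TReal.

Definition hunit x : Prop := hle (hconst N 0) x /\ hle x (hconst N 1).

Lemma near_real_mono x y (r q : R) :
  hle x y -> near_real x r -> near_real y q -> r <= q.
Proof.
move=> xy xr yq; apply/ler_addgt0Pr => e e0.
have e20 : 0 < e / 2 by lra.
have [rx _] := (hdist_le _ _ _).1 (xr _ e20).
have [_ qy] := (hdist_le _ _ _).1 (yq _ e20).
have := (hle_hconst _ _ _).1 (hle_trans rx (hle_trans xy qy)); lra.
Qed.

(** A point [x] of the nonstandard unit interval is near the supremum of the
    standard reals below it. *)
Lemma near_real_st x : hunit x -> near_real x (st x).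
Proof.
move=> [x0 x1]; rewrite /st; suff [r xr] : exists r, near_real x r.
  by case: xgetP => [q -> //|/(_ r)].
pose E := [set q : R | hle (hconst N q) x].
have E1 : ubound E 1.
  by move=> q Eq; apply/(hle_hconst N); exact: hle_trans Eq x1.
have E0 : E !=set0 by exists 0.
exists (sup E) => e e0; apply/hdist_le; split.
  have [|q Eq qe] := @sup_adherent R E e e0; first by split=> //; exists 1.
  by apply: hle_trans Eq; apply/hle_hconst/ltW.
have [//|Ee] := hle_total x (hconst N (sup E + e)).
have : sup E + e <= sup E by apply: ub_le_sup => //; exists 1.
by rewrite gerDl leNgt e0.
Qed.

Lemma st_le x y : hunit x -> hunit y -> hle x y -> st x <= st y.
Proof.
by move=> /near_real_st x1 /near_real_st y1 xy; exact: near_real_mono xy x1 y1.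
Qed.

Lemma near_real_hconst (r : R) : near_real (hconst N r) r.
Proof. by move=> e e0; apply/hdist_le; split; apply/hle_hconst; lra. Qed.

Lemma st_ge0 x : hunit x -> 0 <= st x.
Proof.
move=> x1; exact: near_real_mono x1.1 (near_real_hconst 0) (near_real_st x1).
Qed.

Lemma st_le1 x : hunit x -> st x <= 1.
Proof.
move=> x1; exact: near_real_mono x1.2 (near_real_st x1) (near_real_hconst 1).
Qed.

End StandardPart.

(** * Inner and outer Loeb measure *)

Section InternalAlgebra.
Variables (R : realType) (X : Type) (N : nonstd_ext R X) (s : htype).
Variables (O : dom N (TPow s)) (F : dom N (TPow (TPow s))).
Hypothesis algF : internal_algebra O F.
Implicit Types A B : dom N (TPow s).

Lemma fam_ext A : fam F (ext A) <-> ext F A.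
Proof. by split=> [[B FB /ext_inj<-]|FA] //; exists A. Qed.

Lemma algebra_sub A : ext F A -> ext A `<=` ext O.
Proof. by case: algF => + _ _ _ FA; apply; apply/fam_ext. Qed.

Lemma algebra_top : ext F O.
Proof. by case: algF => _ + _ _; move=> /fam_ext. Qed.

Lemma algebra_setC A : ext F A -> exists2 C, ext F C & ext C = ext O `\` ext A.
Proof. by case: algF => _ _ + _ FA; apply; apply/fam_ext. Qed.

Lemma algebra_setU A B : ext F A -> ext F B ->
  exists2 C, ext F C & ext C = ext A `|` ext B.
Proof. by case: algF => _ _ _ + FA FB; apply; apply/fam_ext. Qed.

Lemma algebra_setD A B : ext F A -> ext F B ->
  exists2 C, ext F C & ext C = ext A `\` ext B.
Proof.
move=> FA FB; have [A' FA' A'E] := algebra_setC FA.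
have [D FD DE] := algebra_setU FA' FB; have [C FC CE] := algebra_setC FD.
exists C => //; rewrite CE DE A'E setDUr setDD [_ `\` _ in RHS]setDE.
rewrite (setIidr (algebra_sub FA)) setDE setIA.
by rewrite (setIidl (algebra_sub FA)).
Qed.

Lemma algebra_set0 : exists2 C, ext F C & ext C = set0.
Proof. by have := algebra_setC algebra_top; rewrite setDv. Qed.

End InternalAlgebra.

Section Loeb.
Variables (R : realType) (X : Type) (N : nonstd_ext R X) (s : htype).
Variables (O : dom N (TPow s)) (F : dom N (TPow (TPow s))).
Variable mu : dom N (TFun (TPow s) TReal).
Hypothesis muP : internal_prob_space O F mu.
Implicit Types (A C : dom N (TPow s)) (B : set (dom N s)).

Let algF : internal_algebra O F. Proof. by case: muP. Qed.

Lemma prob_hunit A : ext F A -> hunit (app mu A).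
Proof. by case: muP => _ + _ _; exact. Qed.

Lemma prob_mono A C : ext F A -> ext F C -> ext A `<=` ext C ->
  hle (app mu A) (app mu C).
Proof.
move=> FA FC AC; have [D FD DE] := algebra_setD algF FC FA.
have [_ _ _ /(_ A D C FA FD FC)->] := muP.
- by apply: hle_addr; case: (prob_hunit FD).
- by rewrite DE setDIK.
- by rewrite DE setDUK.
Qed.

Lemma loeb_inner_ub A B : ext F A -> ext A `<=` B ->
  st (app mu A) <= loeb_inner F mu B.
Proof.
move=> FA AB; apply: ub_le_sup; last by exists A.
by exists 1 => _ [C [FC _] <-]; exact/st_le1/prob_hunit.
Qed.

Lemma loeb_inner_le B (r : R) :
  (forall A, ext F A -> ext A `<=` B -> st (app mu A) <= r) ->
  loeb_inner F mu B <= r.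
Proof.
move=> Br; apply: ge_sup => [|_ [C [FC CB] <-]]; last exact: Br.
have [C FC C0] := algebra_set0 algF.
by exists (st (app mu C)), C => //; split=> //; rewrite C0.
Qed.

Lemma loeb_outer_lb C B : ext F C -> B `<=` ext C ->
  loeb_outer F mu B <= st (app mu C).
Proof.
move=> FC BC; apply: ge_inf; last by exists C.
by exists 0 => _ [A [FA _] <-]; exact/st_ge0/prob_hunit.
Qed.

Lemma loeb_outer_ge B (r : R) : B `<=` ext O ->
  (forall C, ext F C -> B `<=` ext C -> r <= st (app mu C)) ->
  r <= loeb_outer F mu B.
Proof.
move=> BO Br; apply: lb_le_inf => [|_ [C [FC CB] <-]]; last exact: Br.
by exists (st (app mu O)), O => //; split=> //; exact: algebra_top algF.
Qed.

Lemma loeb_inner_ext A : ext F A -> loeb_inner F mu (ext A) = st (app mu A).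
Proof.
move=> FA; apply/eqP; rewrite eq_le loeb_inner_ub// andbT.
apply: loeb_inner_le => C FC CA.
by apply: st_le; [exact: prob_hunit|exact: prob_hunit|exact: prob_mono].
Qed.

Lemma loeb_outer_ext A : ext F A -> loeb_outer F mu (ext A) = st (app mu A).
Proof.
move=> FA; apply/eqP; rewrite eq_le loeb_outer_lb//=.
apply: loeb_outer_ge => [|C FC CA]; first exact: algebra_sub algF _ FA.
by apply: st_le; [exact: prob_hunit|exact: prob_hunit|exact: prob_mono].
Qed.

Lemma sub_loeb_algebra : fam F `<=` loeb_algebra O F mu.
Proof.
move=> _ [A FA <-]; split; first exact: algebra_sub algF _ FA.
by rewrite loeb_inner_ext// loeb_outer_ext.
Qed.

End Loeb.

(** * Extensions within the Loeb algebra *)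

(** Any extension to all internal sets does: additivity bounds it by its value
    on the whole space. *)
Lemma prob_extension (R : realType) (X : Type) (N : nonstd_ext R X) (s : htype)
    (O : dom N (TPow s)) (F H : dom N (TPow (TPow s)))
    (mu : dom N (TFun (TPow s) TReal)) :
  internal_prob_space O F mu -> hyperfinite F -> internal_algebra O H ->
  exists2 P, internal_prob_space O H P &
    forall A, ext F A -> app P A = app mu A.
Proof.
move=> muP Ffin algH; have [algF mu01 muO muU] := muP.
have FO := algebra_top algF.
have [//|//|A B|A /mu01[]//|//|Q [Q0 QU QE]] :=
  @exists_internal_extension R X N s O F mu.
  exact: (algebra_setD algF).
have {}QE A : ext F A -> app Q A = app mu A.
  by move=> FA; apply: QE => //; exact: (algebra_sub algF).
exists Q => //; split=> // [A HA||A B C _ _ _]; [|by rewrite QE|exact: QU].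
split=> //; rewrite -muO -(QE _ FO).
have [A' _ A'E] := algebra_setC algH HA.
rewrite (QU A A' O); first exact: hle_addr.
  by rewrite A'E setDIK.
by rewrite A'E setDUK//; exact: (algebra_sub algH).
Qed.

Section Extension.
Variables (R : realType) (X : Type) (N : nonstd_ext R X) (s : htype).
Variables (O : dom N (TPow s)) (F H : dom N (TPow (TPow s))).
Variables mu P : dom N (TFun (TPow s) TReal).
Hypothesis muP : internal_prob_space O F mu.
Hypothesis FH : ext F `<=` ext H.

Hypothesis PP : internal_prob_space O H P.
Hypothesis PE : forall A, ext F A -> app P A = app mu A.
Hypothesis HL : fam H `<=` loeb_algebra O F mu.

(** A set [A] of [H] inside [B] has the same inner and outer measure for [F], with
    [st (P A)] in between; so [st (P A)] is a supremum over sets of [F] inside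
    [A], which compete in the inner measure of [B] for [F]. *)
Lemma loeb_inner_extension B : loeb_inner H P B = loeb_inner F mu B.
Proof.
apply/eqP; rewrite eq_le; apply/andP; split; last first.
  apply: (loeb_inner_le muP) => A FA AB.
  by rewrite -PE//; apply: (loeb_inner_ub PP) => //; exact: FH.
apply: (loeb_inner_le PP) => A HA AB.
have [|AO AE] := HL (_ : fam H (ext A)); first by exists A.
apply: (@le_trans _ _ (loeb_inner F mu (ext A))).
  rewrite AE; apply: (loeb_outer_ge muP) => // C FC AC; rewrite -PE//.
  rewrite -(loeb_outer_ext PP HA); apply: (loeb_outer_lb PP) => //; exact: FH.
apply: (loeb_inner_le muP) => C FC CA.
apply: (loeb_inner_ub muP) => //; exact: subset_trans AB.
Qed.

(** Dual to [loeb_inner_extension]. *)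
Lemma loeb_outer_extension B :
  B `<=` ext O -> loeb_outer H P B = loeb_outer F mu B.
Proof.
move=> BO; apply/eqP; rewrite eq_le; apply/andP; split.
  apply: (loeb_outer_ge muP) => // C FC BC.
  by rewrite -PE//; apply: (loeb_outer_lb PP) => //; exact: FH.
apply: (loeb_outer_ge PP) => // C HC BC.
have [|CO CE] := HL (_ : fam H (ext C)); first by exists C.
apply: (@le_trans _ _ (loeb_outer F mu (ext C))).
  apply: (loeb_outer_ge muP) => // D FD CD.
  apply: (loeb_outer_lb muP) => //; exact: subset_trans CD.
rewrite -CE; apply: (loeb_inner_le muP) => D FD DC; rewrite -PE//.
rewrite -(loeb_inner_ext PP HC); apply: (loeb_inner_ub PP) => //; exact: FH.
Qed.

Lemma loeb_equivalent_extension : loeb_equivalent O H P F mu.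
Proof.
split; last by move=> B _; exact: loeb_inner_extension.
apply/seteqP; split=> B [BO BE]; split=> //; move: BE;
  by rewrite loeb_inner_extension loeb_outer_extension.
Qed.

End Extension.

Theorem theorem3p4 (R : realType) (X : Type) (N : nonstd_ext R X) (s : htype)
    (O : dom N (TPow s)) (F G H : dom N (TPow (TPow s)))
    (mu : dom N (TFun (TPow s) TReal)) :
  hyperfinite_prob_space O F mu ->
  hyperfinite_algebra O G ->
  generated_algebra O (ext F `|` ext G) H ->
  (exists P : dom N (TFun (TPow s) TReal),
      internal_prob_space O H P /\ loeb_equivalent O H P F mu)
  <-> fam H `<=` loeb_algebra O F mu.
Proof.
move=> [muP Ffin] _ [algH FGH _]; have FH : ext F `<=` ext H.
  by move=> A FA; apply: FGH; left.
split=> [[P [PP [<- _]]]|HL]; first exact: sub_loeb_algebra PP.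
have [P PP PE] := prob_extension muP Ffin algH.
by exists P; split=> //; exact: (loeb_equivalent_extension muP FH PP PE HL).
Qed.
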